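(* Let $F$ be a field. Let $M_1$ be the vector space $F[t]$ with the double bracket $$\{\!\{t^n,t^m\}\!\}=-\frac{t^n\otimes t^{m+1}-t^m\otimes t^{n+1}}{t\otimes 1-1\otimes t}\qquad(n,m\ge 0),$$ and let $M_2$ be the vector space $F[t]$ with the double bracket $$\{\!\{t^n,t^m\}\!\}=\frac{t^{n+1}\otimes t^m-t^{m+1}\otimes t^n}{t\otimes 1-1\otimes t}\qquad(n,m\ge 0).$$ Each of the $1$-double Lie algebras $M_1$ and $M_2$ has only one nonzero proper ideal, namely $I=tF[t]$. Moreover, in each case $I$ (with the restricted double bracket) is isomorphic to the whole double Lie algebra.
   Context: A double bracket on a vector space $V$ is a linear map $V\otimes V\to V\otimes V$, $a\otimes b\mapsto\{\!\{a,b\}\!\}$. The fractions above denote exact division in the commutative algebra $F[t]\otimes F[t]\cong F[x,y]$ ($x=t\otimes 1$, $y=1\otimes t$). For $u\in V^{\otimes n}$ and $\sigma\in S_n$, $u^\sigma$ denotes $u$ with tensor factors permuted by $\sigma$ (so $(x\otimes y)^{(12)}=y\otimes x$, $(x\otimes y\otimes z)^{(12)}=y\otimes x\otimes z$, $(x\otimes y\otimes z)^{(23)}=x\otimes z\otimes y$). Put, extended linearly, $\{\!\{a,b\otimes c\}\!\}_L=\{\!\{a,b\}\!\}\otimes c$, $\{\!\{a,b\otimes c\}\!\}_R=b\otimes\{\!\{a,c\}\!\}$, $\{\!\{a\otimes b,c\}\!\}_L=(\{\!\{a,c\}\!\}\otimes b)^{(23)}$. A $\lambda$-double Lie algebra ($\lambda\in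 F$) is a vector space $V$ with a double bracket such that for all $a,b,c\in V$: $$\{\!\{a,b\}\!\}+\{\!\{b,a\}\!\}^{(12)}=\lambda(a\otimes b-b\otimes a),$$ $$\{\!\{a,\{\!\{b,c\}\!\}\}\!\}_L-\{\!\{b,\{\!\{a,c\}\!\}\}\!\}_R-\{\!\{\{\!\{a,b\}\!\},c\}\!\}_L=-\lambda(b\otimes\{\!\{a,c\}\!\})^{(12)}.$$ $M_1$ and $M_2$ are $1$-double Lie algebras. An ideal of $V$ is a subspace $I\subseteq V$ with $\{\!\{V,I\}\!\}+\{\!\{I,V\}\!\}\subseteq I\otimes V+V\otimes I$. An isomorphism $\varphi\colon L\to L'$ is a bijective linear map with $(\varphi\otimes\varphi)(\{\!\{a,b\}\!\})=\{\!\{\varphi(a),\varphi(b)\}\!\}$ for all $a,b\in L$. *)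

(* Defs.v *)
From HB Require Import structures.
From mathcomp Require Import all_boot all_order all_algebra.
From mathcomp Require Import generic_quotient boolp classical_sets.
From mathcomp Require Import ring.

Set Implicit Arguments.
Unset Strict Implicit.
Unset Printing Implicit Defensive.

Import GRing.Theory.
Local Open Scope ring_scope.
Local Open Scope quotient_scope.

Section Tensor.
Variables (F : fieldType) (U V : lmodType F).

Definition formal_eval (W : lmodType F) (f : {bilinear U -> V -> W})
    (s : seq (U * V)) : W := \sum_(p <- s) f p.1 p.2.

(* A list of pairs stands for the sum of the pure tensors it contains (scalars
   are absorbed into the left entries); two lists are identified when no
   bilinear map tells them apart. The universal property is [tlift_pure] and
   [tensor_ind] below. *)
Definition tensor_rel (s s' : seq (U * V)) : bool :=
  `[< forall (W : lmodType F) (f : {bilinear U -> V -> W}),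
        formal_eval f s = formal_eval f s' >].

Lemma tensor_rel_refl : reflexive tensor_rel.
Proof. by move=> s; apply/asboolP. Qed.

Lemma tensor_rel_sym : symmetric tensor_rel.
Proof.
by move=> s s'; apply/asboolP/asboolP => h W f; rewrite (h W f).
Qed.

Lemma tensor_rel_trans : transitive tensor_rel.
Proof.
by move=> s2 s1 s3 /asboolP h /asboolP h'; apply/asboolP => W f; rewrite h h'.
Qed.

Canonical tensor_equiv :=
  EquivRel tensor_rel tensor_rel_refl tensor_rel_sym tensor_rel_trans.

Definition tensor := {eq_quot tensor_rel}.
HB.instance Definition _ := Choice.on tensor.
HB.instance Definition _ := EqQuotient.on tensor.

Definition tensor_of (s : seq (U * V)) : tensor := \pi_tensor s.

Definition teval (W : lmodType F) (f : {bilinear U -> V -> W}) (x : tensor) :=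
  formal_eval f (repr x).

Lemma teval_of (W : lmodType F) (f : {bilinear U -> V -> W}) s :
  teval f (tensor_of s) = formal_eval f s.
Proof.
rewrite /teval /tensor_of.
have /eqP : tensor_of (repr (\pi_tensor s)) = \pi_tensor s by exact: reprK.
rewrite /tensor_of piE => /asboolP; exact.
Qed.

Lemma teval_inj (x y : tensor) :
  (forall (W : lmodType F) (f : {bilinear U -> V -> W}), teval f x = teval f y) -> x = y.
Proof.
move=> h; rewrite -[x]reprK -[y]reprK; apply/eqP; rewrite piE.
exact/asboolP.
Qed.

Definition tadd (x y : tensor) := tensor_of (repr x ++ repr y).
Definition tzero := tensor_of [::].
Definition tscale (a : F) (x : tensor) :=
  tensor_of [seq (a *: p.1, p.2) | p <- repr x].
Definition topp := tscale (-1).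

Lemma tevalD (W : lmodType F) (f : {bilinear U -> V -> W}) x y :
  teval f (tadd x y) = teval f x + teval f y.
Proof. by rewrite teval_of /formal_eval big_cat. Qed.

Lemma teval0 (W : lmodType F) (f : {bilinear U -> V -> W}) : teval f tzero = 0.
Proof. by rewrite teval_of /formal_eval big_nil. Qed.

Lemma tevalZ (W : lmodType F) (f : {bilinear U -> V -> W}) a x :
  teval f (tscale a x) = a *: teval f x.
Proof.
rewrite teval_of /formal_eval big_map scaler_sumr.
by apply: eq_bigr => p _; rewrite linearZl_LR.
Qed.

Let tevalE := (tevalD, teval0, tevalZ).

Lemma taddA : associative tadd.
Proof. by move=> *; apply: teval_inj => W f; rewrite !tevalE addrA. Qed.
Lemma taddC : commutative tadd.
Proof. by move=> *; apply: teval_inj => W f; rewrite !tevalE addrC. Qed.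
Lemma tadd0 : left_id tzero tadd.
Proof. by move=> *; apply: teval_inj => W f; rewrite !tevalE add0r. Qed.
Lemma taddN : left_inverse tzero topp tadd.
Proof.
by move=> *; apply: teval_inj => W f; rewrite !tevalE scaleN1r addNr.
Qed.

HB.instance Definition _ :=
  GRing.isZmodule.Build tensor taddA taddC tadd0 taddN.

Lemma tscaleA a b x : tscale a (tscale b x) = tscale (a * b) x.
Proof. by apply: teval_inj => W f; rewrite !tevalE scalerA. Qed.
Lemma tscale1 : left_id 1 tscale.
Proof. by move=> x; apply: teval_inj => W f; rewrite !tevalE scale1r. Qed.
Lemma tscaleDr : right_distributive tscale +%R.
Proof. by move=> *; apply: teval_inj => W f; rewrite !tevalE scalerDr. Qed.
Lemma tscaleDl x : {morph tscale^~ x : a b / a + b}.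
Proof. by move=> *; apply: teval_inj => W f; rewrite !tevalE scalerDl. Qed.

HB.instance Definition _ := GRing.Zmodule_isLmodule.Build F tensor
  tscaleA tscale1 tscaleDr tscaleDl.

Definition pure (u : U) (v : V) : tensor := tensor_of [:: (u, v)].

Lemma teval_pure (W : lmodType F) (f : {bilinear U -> V -> W}) u v :
  teval f (pure u v) = f u v.
Proof. by rewrite teval_of /formal_eval big_seq1. Qed.

Lemma pure_bilinear : bilinear_for *:%R *:%R pure.
Proof.
by split=> [v|u] a x y; apply: teval_inj => W f;
  rewrite tevalD tevalZ !teval_pure ?linearPl ?linearPr.
Qed.

HB.instance Definition _ :=
  bilinear_isBilinear.Build F U V tensor *:%R *:%R pure pure_bilinear.

Definition tlift (W : lmodType F) (f : {bilinear U -> V -> W}) : tensor -> W :=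
  teval f.

Lemma tlift_linear (W : lmodType F) (f : {bilinear U -> V -> W}) : linear (tlift f).
Proof. by move=> a x y; rewrite /tlift tevalD tevalZ. Qed.

HB.instance Definition _ (W : lmodType F) (f : {bilinear U -> V -> W}) :=
  GRing.isLinear.Build F tensor W *:%R (tlift f) (tlift_linear f).

Lemma tlift_pure (W : lmodType F) (f : {bilinear U -> V -> W}) u v :
  tlift f (pure u v) = f u v.
Proof. exact: teval_pure. Qed.

Lemma tensor_sum (x : tensor) : x = \sum_(p <- repr x) pure p.1 p.2.
Proof.
apply: teval_inj => W f; rewrite -!/(tlift f _) linear_sum /=.
by under eq_bigr do rewrite tlift_pure.
Qed.

Lemma tensor_ind (P : tensor -> Prop) :
  (forall u v, P (pure u v)) -> P 0 -> (forall x y, P x -> P y -> P (x + y)) ->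
  forall x, P x.
Proof.
move=> Pp P0 PD x; rewrite (tensor_sum x).
by apply: (big_ind P) => // p _; apply: Pp.
Qed.

Lemma tensor_ext (W : lmodType F) (f g : {linear tensor -> W}) :
  (forall u v, f (pure u v) = g (pure u v)) -> f =1 g.
Proof.
move=> h; apply: tensor_ind => [//||x y hx hy]; first by rewrite !linear0.
by rewrite !linearD hx hy.
Qed.

End Tensor.

(* Unfolding the quotient makes failing unifications very slow. *)
#[global] Opaque tensor_rel tensor tensor_of teval tadd tzero tscale topp pure.

Notation "u ⊗ v" := (pure u v) (at level 40, left associativity) : ring_scope.

Section TensorMaps.
Variable F : fieldType.

Lemma bilinearP (U V W : lmodType F) (f : U -> V -> W) :
  (forall v, linear (f^~ v)) -> (forall u, linear (f u)) ->
  bilinear_for *:%R *:%R f.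
Proof. by []. Qed.

Section Tmap.
Variables (U U' V V' : lmodType F).
Variables (f : {linear U -> U'}) (g : {linear V -> V'}).

Definition tmap_fun (u : U) (v : V) : tensor U' V' := f u ⊗ g v.

Lemma tmap_bilinear : bilinear_for *:%R *:%R tmap_fun.
Proof.
by split=> [v|u] a x y; rewrite /tmap_fun linearP ?linearPl ?linearPr.
Qed.
HB.instance Definition _ := bilinear_isBilinear.Build F U V (tensor U' V')
  *:%R *:%R tmap_fun tmap_bilinear.

Definition tmap : {linear tensor U V -> tensor U' V'} := tlift tmap_fun.

Lemma tmap_pure u v : tmap (u ⊗ v) = f u ⊗ g v.
Proof. exact: tlift_pure. Qed.

End Tmap.

Section Swap.
Variables (U V : lmodType F).

Definition tswap_fun (u : U) (v : V) : tensor V U := v ⊗ u.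

Lemma tswap_bilinear : bilinear_for *:%R *:%R tswap_fun.
Proof. by split=> [v|u] a x y; rewrite /tswap_fun ?linearPl ?linearPr. Qed.
HB.instance Definition _ := bilinear_isBilinear.Build F U V (tensor V U)
  *:%R *:%R tswap_fun tswap_bilinear.

Definition tswap : {linear tensor U V -> tensor V U} := tlift tswap_fun.

Lemma tswap_pure u v : tswap (u ⊗ v) = v ⊗ u.
Proof. exact: tlift_pure. Qed.

Definition purer (u : U) (v : V) : tensor U V := u ⊗ v.
Lemma purer_linear u : linear (purer u).
Proof. by move=> a x y; rewrite /purer linearPr. Qed.
HB.instance Definition _ u :=
  GRing.isLinear.Build F V (tensor U V) *:%R (purer u) (purer_linear u).

Definition purel (v : V) (u : U) : tensor U V := u ⊗ v.
Lemma purel_linear v : linear (purel v).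
Proof. by move=> a x y; rewrite /purel linearPl. Qed.
HB.instance Definition _ v :=
  GRing.isLinear.Build F U (tensor U V) *:%R (purel v) (purel_linear v).

End Swap.

Section Triple.
Variables (U V W : lmodType F).

Definition tassoc_fun (u : U) (x : tensor V W) : tensor (tensor U V) W :=
  tmap (@purer U V u) idfun x.

Lemma tassoc_bilinear : bilinear_for *:%R *:%R tassoc_fun.
Proof.
apply: bilinearP => [x|u] a y z; last exact: linearP.
elim/tensor_ind: x => [v w||x x' hx hx']; rewrite /tassoc_fun.
- by rewrite !tmap_pure /= /purer !linearPl.
- by rewrite !linear0 addr0.
- by rewrite !linearD /= -!/(tassoc_fun _ _) hx hx' addrACA.
Qed.
HB.instance Definition _ := bilinear_isBilinear.Build F U (tensor V W)
  (tensor (tensor U V) W) *:%R *:%R tassoc_fun tassoc_bilinear.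

Definition tassoc :
    {linear tensor U (tensor V W) -> tensor (tensor U V) W} :=
  tlift tassoc_fun.

Lemma tassoc_pure u v w : tassoc (u ⊗ (v ⊗ w)) = u ⊗ v ⊗ w.
Proof. by rewrite [LHS]tlift_pure [LHS]tmap_pure. Qed.

Definition perm23_fun (x : tensor U V) (w : W) : tensor (tensor U W) V :=
  tmap (@purel U W w) idfun x.

Lemma perm23_bilinear : bilinear_for *:%R *:%R perm23_fun.
Proof.
apply: bilinearP => [w|x] a y z; first exact: linearP.
elim/tensor_ind: x => [u v||x x' hx hx']; rewrite /perm23_fun.
- by rewrite !tmap_pure /= /purel linearPr linearPl.
- by rewrite !linear0 addr0.
- by rewrite !linearD /= -!/(perm23_fun _ _) hx hx' addrACA.
Qed.
HB.instance Definition _ := bilinear_isBilinear.Build F (tensor U V) W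
  (tensor (tensor U W) V) *:%R *:%R perm23_fun perm23_bilinear.

Definition perm23 :
    {linear tensor (tensor U V) W -> tensor (tensor U W) V} :=
  tlift perm23_fun.

Lemma perm23_pure u v w : perm23 (u ⊗ v ⊗ w) = u ⊗ w ⊗ v.
Proof. by rewrite [LHS]tlift_pure [LHS]tmap_pure. Qed.

Definition perm12 :
    {linear tensor (tensor U V) W -> tensor (tensor V U) W} :=
  tmap (@tswap U V) idfun.

Lemma perm12_pure u v w : perm12 (u ⊗ v ⊗ w) = v ⊗ u ⊗ w.
Proof. by rewrite [LHS]tmap_pure [X in X ⊗ _]tswap_pure. Qed.

End Triple.
End TensorMaps.
Arguments tswap {F U V}.
Arguments tassoc {F U V W}.
Arguments perm12 {F U V W}.
Arguments perm23 {F U V W}.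

Notation double_bracket V := {linear tensor V V -> tensor V V}.

Section DoubleBracket.
Variables (F : fieldType) (V : lmodType F).

Variable br : double_bracket V.

Definition bracketr (a b : V) : tensor V V := br (a ⊗ b).
Definition bracketl (b a : V) : tensor V V := br (a ⊗ b).

Lemma bracketr_linear a : linear (bracketr a).
Proof. by move=> k x y; rewrite /bracketr linearPr linearP. Qed.
HB.instance Definition _ a := GRing.isLinear.Build F V (tensor V V) *:%R
  (bracketr a) (bracketr_linear a).

Lemma bracketl_linear b : linear (bracketl b).
Proof. by move=> k x y; rewrite /bracketl linearPl linearP. Qed.
HB.instance Definition _ b := GRing.isLinear.Build F V (tensor V V) *:%R
  (bracketl b) (bracketl_linear b).

(* The third tensor power is (V ⊗ V) ⊗ V. With { , } the double bracket,
   bracket_Lr a (b ⊗ c) = {a, b} ⊗ c       written {a, b ⊗ c}_L,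
   bracket_R a (b ⊗ c)  = b ⊗ {a, c}       written {a, b ⊗ c}_R,
   bracket_Ll (a ⊗ b) c = ({a, c} ⊗ b)^(23) written {a ⊗ b, c}_L. *)
Definition bracket_Lr (a : V) (u : tensor V V) : tensor (tensor V V) V :=
  tmap (bracketr a) idfun u.
Definition bracket_R (a : V) (u : tensor V V) : tensor (tensor V V) V :=
  tassoc (tmap idfun (bracketr a) u).
Definition bracket_Ll (u : tensor V V) (c : V) : tensor (tensor V V) V :=
  perm23 (tmap (bracketl c) idfun u).

Definition skew_axiom (lambda : F) : Prop := forall a b : V,
  br (a ⊗ b) + tswap (br (b ⊗ a)) = lambda *: (a ⊗ b - b ⊗ a).

Definition jacobi_axiom (lambda : F) : Prop := forall a b c : V,
  bracket_Lr a (br (b ⊗ c)) - bracket_R b (br (a ⊗ c))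
    - bracket_Ll (br (a ⊗ b)) c
  = - (lambda *: perm12 (tassoc (b ⊗ br (a ⊗ c)))).

End DoubleBracket.

Record double_lie (F : fieldType) (lambda : F) (V : lmodType F) := DoubleLie {
  dbr :> double_bracket V;
  dbr_skew : skew_axiom dbr lambda;
  dbr_jacobi : jacobi_axiom dbr lambda
}.

Section Subspaces.
Variables (F : fieldType) (V : lmodType F).

Definition subspace (I : submodClosed V) := {v : V | v \in I}.
HB.instance Definition _ (I : submodClosed V) := SubChoice.on (subspace I).
HB.instance Definition _ (I : submodClosed V) :=
  [SubChoice_isSubLmodule of subspace I by <:].

Definition incl (I : submodClosed V) : {linear subspace I -> V} := \val.

(* Membership in I ⊗ V + V ⊗ I, seen inside V ⊗ V. *)
Definition in_ideal_tensor (I : submodClosed V) (x : tensor V V) : Prop :=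
  exists (y : tensor (subspace I) V) (z : tensor V (subspace I)),
    x = tmap (incl I) idfun y + tmap idfun (incl I) z.

Definition is_ideal (lambda : F) (L : double_lie lambda V)
    (I : submodClosed V) : Prop :=
  forall v i, i \in I ->
    in_ideal_tensor I (L (v ⊗ i)) /\ in_ideal_tensor I (L (i ⊗ v)).

(* The inclusion I ⊗ I -> V ⊗ V is injective, so L determines N. *)
Definition is_restriction (lambda : F) (I : submodClosed V)
    (L : double_lie lambda V) (N : double_lie lambda (subspace I)) : Prop :=
  forall a b : subspace I,
    tmap (incl I) (incl I) (N (a ⊗ b)) = L (incl I a ⊗ incl I b).

End Subspaces.

Definition dlie_isomorphic (F : fieldType) (lambda : F) (V W : lmodType F)
    (L : double_lie lambda V) (L' : double_lie lambda W) : Prop :=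
  exists phi : {linear V -> W}, bijective phi /\
    forall a b : V, tmap phi phi (L (a ⊗ b)) = L' (phi a ⊗ phi b).


Section TensorAlgebra.
Variables (F : fieldType) (A B : algType F).

Definition tmul_fun (y : tensor A B) (a : A) (b : B) : tensor A B :=
  tmap (a \*o idfun) (b \*o idfun) y.

Lemma tmul_fun_pure c d a b : tmul_fun (c ⊗ d) a b = (a * c) ⊗ (b * d).
Proof. exact: tmap_pure. Qed.

Lemma tmul_fun_bilinear y : bilinear_for *:%R *:%R (tmul_fun y).
Proof.
apply: bilinearP => w k u v; elim/tensor_ind: y => [c d||y y' hy hy'].
- by rewrite !tmul_fun_pure mulrDl -scalerAl linearPl.
- by rewrite /tmul_fun !linear0 addr0.
- by move: hy hy'; rewrite /tmul_fun !linearD /= => -> ->; rewrite addrACA.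
- by rewrite !tmul_fun_pure mulrDl -scalerAl linearPr.
- by rewrite /tmul_fun !linear0 addr0.
- by move: hy hy'; rewrite /tmul_fun !linearD /= => -> ->; rewrite addrACA.
Qed.
HB.instance Definition _ y := bilinear_isBilinear.Build F A B (tensor A B)
  *:%R *:%R (tmul_fun y) (tmul_fun_bilinear y).

Definition tmul (x y : tensor A B) : tensor A B := tlift (tmul_fun y) x.

Lemma tmul_pure a b c d : tmul (a ⊗ b) (c ⊗ d) = (a * c) ⊗ (b * d).
Proof. by rewrite [LHS]tlift_pure; exact: tmul_fun_pure. Qed.

Lemma tmulDl x x' y : tmul (x + x') y = tmul x y + tmul x' y.
Proof. exact: linearD. Qed.

Lemma tmulDr x y y' : tmul x (y + y') = tmul x y + tmul x y'.
Proof.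
elim/tensor_ind: x => [a b||x x' hx hx'].
- by rewrite /tmul !tlift_pure /= /tmul_fun linearD.
- by rewrite /tmul !linear0 addr0.
- by rewrite !tmulDl hx hx' addrACA.
Qed.

(* Exact division: a q with d q = n when there is one, and 0 otherwise. For the
   quotients used below q exists by [M1_exact] and [M2_exact], and it is unique
   by [x_sub_y_reg]. *)
Definition tdiv (n d : tensor A B) : tensor A B := xget 0 [set q | tmul d q = n].

End TensorAlgebra.

Section PolyBracket.
Variable F : fieldType.
Implicit Types (p q : {poly F}).

Definition linext (W : lmodType F) (g : nat -> W) (p : {poly F}) : W :=
  \sum_(i < size p) p`_i *: g i.

Lemma linext_wide (W : lmodType F) (g : nat -> W) p n : (size p <= n)%N ->
  linext g p = \sum_(i < n) p`_i *: g i.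
Proof.
move=> le_pn; rewrite /linext (big_ord_widen n (fun i => p`_i *: g i)) //.
rewrite big_mkcond /=; apply: eq_bigr => i _; case: ltnP => // le_pi.
by rewrite nth_default ?scale0r.
Qed.

Lemma linext_linear (W : lmodType F) (g : nat -> W) : linear (linext g).
Proof.
move=> k p q; pose n := maxn (size p) (size q).
have le_n : (size (k *: p + q)%R <= n)%N.
  apply: (leq_trans (size_polyD _ _)); rewrite geq_max leq_maxr andbT.
  by rewrite (leq_trans (size_scale_leq _ _)) ?leq_maxl.
rewrite (linext_wide _ le_n) (@linext_wide _ _ p n) ?leq_maxl //.
rewrite (@linext_wide _ _ q n) ?leq_maxr // scaler_sumr -big_split /=.
by apply: eq_bigr => i _; rewrite coefD coefZ scalerDl scalerA.
Qed.
HB.instance Definition _ (W : lmodType F) (g : nat -> W) :=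
  GRing.isLinear.Build F {poly F} W *:%R (linext g) (linext_linear g).

Lemma linextXn (W : lmodType F) (g : nat -> W) n : linext g 'X^n = g n.
Proof.
rewrite /linext size_polyXn big_ord_recr /= coefXn eqxx scale1r.
rewrite big1 ?add0r // => i _; rewrite coefXn.
by rewrite ltn_eqF ?scale0r // ltn_ord.
Qed.

Section LinExt2.
Variables (W : lmodType F) (g : nat -> nat -> W).

Definition linext2_fun p q : W := linext (fun n => linext (g n) q) p.

Lemma linext2_bilinear : bilinear_for *:%R *:%R linext2_fun.
Proof.
apply: bilinearP => [q|p] k u v; first exact: linearP.
rewrite /linext2_fun /linext scaler_sumr -big_split /=.
apply: eq_bigr => i _; rewrite -!/(linext _ _) linearP scalerDr.
by rewrite !scalerA mulrC.
Qed.
HB.instance Definition _ := bilinear_isBilinear.Build F {poly F} {poly F} W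
  *:%R *:%R linext2_fun linext2_bilinear.

Definition linext2 : {linear tensor {poly F} {poly F} -> W} :=
  tlift linext2_fun.

Lemma linext2_Xn n m : linext2 ('X^n ⊗ 'X^m) = g n m.
Proof. by rewrite [LHS]tlift_pure /= /linext2_fun !linextXn. Qed.

End LinExt2.

(* F[t] ⊗ F[t] is F[x, y], with x = t ⊗ 1 and y = 1 ⊗ t. *)
Definition x_sub_y : tensor {poly F} {poly F} := 'X ⊗ 1 - 1 ⊗ 'X.

Definition M1_bracket : double_bracket {poly F} :=
  linext2 (fun n m =>
    - tdiv ('X^n ⊗ 'X^(m.+1) - 'X^m ⊗ 'X^(n.+1)) x_sub_y).

Definition M2_bracket : double_bracket {poly F} :=
  linext2 (fun n m =>
    tdiv ('X^(n.+1) ⊗ 'X^m - 'X^(m.+1) ⊗ 'X^n) x_sub_y).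

End PolyBracket.

Section ExactDivision.
Variable F : fieldType.
Let T := tensor {poly F} {poly F}.
Local Notation d := (x_sub_y F).

Lemma tmulNr (A B : algType F) (x y : tensor A B) : tmul x (- y) = - tmul x y.
Proof.
by apply/eqP; rewrite -addr_eq0 -tmulDr addNr; apply/eqP;
  apply: (@addrI _ (tmul x 0)); rewrite -tmulDr !addr0.
Qed.

Lemma dvd_diff k a b : exists q : T,
  tmul d q = 'X^(a + k) ⊗ 'X^b - 'X^a ⊗ 'X^(b + k).
Proof.
elim: k a b => [|k IHk] a b.
  exists 0; rewrite !addn0 subrr.
  by apply: (@addrI _ (tmul d 0)); rewrite -tmulDr !addr0.
have [q hq] := IHk a b.+1.
exists ('X^(a + k) ⊗ 'X^b + q).
rewrite tmulDr hq /x_sub_y tmulDl.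
rewrite -[X in tmul X _ + _]/('X ⊗ 1) -[- (1 ⊗ 'X)](linearNl (@pure F _ _)).
rewrite !tmul_pure mulNr linearNl !mul1r -!exprS !addnS addSn.
by rewrite addrA addrNK.
Qed.

Lemma tdivP (n : T) : (exists q, tmul d q = n) -> tmul d (tdiv n d) = n.
Proof. by case=> q hq; rewrite /tdiv; case: xgetP => // /(_ q) []. Qed.

Lemma dvd_opp (n : T) :
  (exists q, tmul d q = n) -> exists q, tmul d q = - n.
Proof. by case=> q <-; exists (- q); rewrite tmulNr. Qed.

Lemma M1_exact n m : tmul d
    (tdiv ('X^n ⊗ 'X^(m.+1) - 'X^m ⊗ 'X^(n.+1)) d)
  = 'X^n ⊗ 'X^(m.+1) - 'X^m ⊗ 'X^(n.+1).
Proof.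
apply: tdivP; case: (leqP n m) => [le_nm|/ltnW le_mn].
  rewrite -[X in exists q, _ = X]opprB; apply: dvd_opp.
  by have := dvd_diff (m - n) n n.+1; rewrite addSn !subnKC.
by have := dvd_diff (n - m) m m.+1; rewrite addSn !subnKC.
Qed.

Lemma M2_exact n m : tmul d
    (tdiv ('X^(n.+1) ⊗ 'X^m - 'X^(m.+1) ⊗ 'X^n) d)
  = 'X^(n.+1) ⊗ 'X^m - 'X^(m.+1) ⊗ 'X^n.
Proof.
apply: tdivP; case: (leqP n m) => [le_nm|/ltnW le_mn].
  rewrite -[X in exists q, _ = X]opprB; apply: dvd_opp.
  by have := dvd_diff (m - n) n.+1 n; rewrite addSn !subnKC.
by have := dvd_diff (n - m) m.+1 m; rewrite addSn !subnKC.
Qed.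

End ExactDivision.

Section Evaluation.
Variables (F : fieldType) (R : comNzRingType) (phi : {rmorphism F -> R}).

(* R with the F-module structure given by phi. *)
Definition rscal (f : {rmorphism F -> R}) : Type := R.
HB.instance Definition _ := GRing.Zmodule.on (rscal phi).

Lemma rscalA (a b : F) (x : rscal phi) :
  phi a * (phi b * x : R) = phi (a * b) * x.
Proof. by rewrite rmorphM mulrA. Qed.
Lemma rscal1 (x : rscal phi) : phi 1 * (x : R) = x.
Proof. by rewrite rmorph1 mul1r. Qed.
Lemma rscalDr (a : F) (x y : rscal phi) :
  phi a * (x + y : R) = phi a * (x : R) + phi a * (y : R).
Proof. by rewrite mulrDr. Qed.
Lemma rscalDl (x : rscal phi) (a b : F) :
  phi (a + b) * (x : R) = phi a * (x : R) + phi b * (x : R).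
Proof. by rewrite rmorphD mulrDl. Qed.
HB.instance Definition _ := GRing.Zmodule_isLmodule.Build F (rscal phi)
  rscalA rscal1 rscalDr rscalDl.

Lemma rscalE (a : F) (x : rscal phi) : a *: x = phi a * (x : R).
Proof. by []. Qed.

Section Tev.
Variables (U V : lmodType F).
Variables (f : {linear U -> rscal phi}) (g : {linear V -> rscal phi}).

Definition tev_fun (u : U) (v : V) : rscal phi := (f u : R) * g v.
Lemma tev_bilinear : bilinear_for *:%R *:%R tev_fun.
Proof.
apply: bilinearP => [v|u] a x y; rewrite /tev_fun linearP !rscalE.
  by rewrite mulrDl mulrA.
by rewrite mulrDr mulrCA.
Qed.
HB.instance Definition _ := bilinear_isBilinear.Build F U V (rscal phi)
  *:%R *:%R tev_fun tev_bilinear.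

Definition tev : {linear tensor U V -> rscal phi} := tlift tev_fun.

Lemma tev_pure u v : tev (u ⊗ v) = (f u : R) * g v.
Proof. exact: tlift_pure. Qed.
End Tev.

Definition evp (x : R) (p : {poly F}) : rscal phi := (map_poly phi p).[x].
Lemma evp_linear x : linear (evp x).
Proof.
by move=> a p q; rewrite /evp rmorphD /= map_polyZ hornerD hornerZ.
Qed.
HB.instance Definition _ x :=
  GRing.isLinear.Build F {poly F} (rscal phi) *:%R (evp x) (evp_linear x).

Lemma evpXn x n : evp x 'X^n = x ^+ n.
Proof. by rewrite /evp map_polyXn hornerXn. Qed.

Lemma evpM x p q : evp x (p * q) = (evp x p : R) * evp x q.
Proof. by rewrite /evp rmorphM hornerM. Qed.

Definition ev2 (x y : R) : {linear tensor {poly F} {poly F} -> rscal phi} :=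
  tev (evp x) (evp y).

Definition ev3 (x y z : R) :
    {linear tensor (tensor {poly F} {poly F}) {poly F} -> rscal phi} :=
  tev (ev2 x y) (evp z).

Lemma ev2M x y u v : ev2 x y (tmul u v) = (ev2 x y u : R) * ev2 x y v.
Proof.
elim/tensor_ind: u => [a b||u u' hu hu'].
- elim/tensor_ind: v => [c e||v v' hv hv'].
  + by rewrite tmul_pure !tev_pure /= !evpM mulrACA.
  + by rewrite /tmul tlift_pure /= /tmul_fun !linear0 mulr0.
  + by rewrite tmulDr !linearD hv hv' mulrDr.
- by rewrite /tmul !linear0 mul0r.
- by rewrite tmulDl !linearD hu hu' mulrDl.
Qed.

Lemma ev2_x_sub_y x y : ev2 x y (x_sub_y F) = x - y :> R.
Proof.
rewrite /x_sub_y linearB !tev_pure /= -['X]expr1 -(expr0 'X) !evpXn !expr1.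
by rewrite !expr0 mulr1 mul1r.
Qed.

Lemma ev2_swap x y u : ev2 x y (tswap u) = ev2 y x u.
Proof.
elim/tensor_ind: u => [a b||u u' hu hu'].
- by rewrite tswap_pure !tev_pure mulrC.
- by rewrite !linear0.
- by rewrite !linearD hu hu'.
Qed.

End Evaluation.

Section GenericPoints.
Variable F : fieldType.

Lemma tensor_poly_sum (U : lmodType F) (x : tensor U {poly F}) :
  exists n (w : nat -> U), x = \sum_(k < n) w k ⊗ 'X^k.
Proof.
elim/tensor_ind: x => [u p||x y [n [w ->]] [m [v ->]]].
- exists (size p), (fun k => p`_k *: u).
  rewrite -{1}[p]coefK poly_def linear_sumr /=; apply: eq_bigr => k _.
  by rewrite linearZl_LR linearZr_LR.
- by exists 0%N, (fun=> 0); rewrite big_ord0.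
exists (maxn n m), (fun k => (if (k < n)%N then w k else 0) +
                             (if (k < m)%N then v k else 0)).
under [RHS]eq_bigr do rewrite linearDl.
rewrite big_split /=; congr (_ + _).
  rewrite (big_ord_widen (maxn n m) (fun k => w k ⊗ 'X^k)) ?leq_maxl //.
  by rewrite big_mkcond; apply: eq_bigr => k _; case: ifP; rewrite ?linear0l.
rewrite (big_ord_widen (maxn n m) (fun k => v k ⊗ 'X^k)) ?leq_maxr //.
by rewrite big_mkcond; apply: eq_bigr => k _; case: ifP; rewrite ?linear0l.
Qed.

Section Step.
Variables (R : comNzRingType) (phi : {rmorphism F -> R}).
Variables (psi : {rmorphism F -> {poly R}}).
Variables (U : lmodType F) (f : {linear U -> rscal phi}).
Variables (g : {linear U -> rscal psi}).

Lemma tev_inj :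
  (forall u, g u = (f u : R)%:P) -> (forall u, f u = 0 -> u = 0) ->
  forall x, tev g (evp psi 'X) x = 0 -> x = 0.
Proof.
move=> gE f0 x; have [n [w ->]] := tensor_poly_sum x; rewrite linear_sum /=.
under eq_bigr do rewrite tev_pure /= evpXn gE mul_polyC.
rewrite -(poly_def n (fun k => f (w k) : R)) => h.
apply: big1 => k _; rewrite (f0 (w k)) ?linear0l //.
by have := congr1 (fun p : {poly R} => p`_k) h; rewrite coef_poly ltn_ord coef0.
Qed.

End Step.

Section Transfer.
Variables (R S : comNzRingType) (h : {rmorphism R -> S}).
Variables (phi : {rmorphism F -> R}) (psi : {rmorphism F -> S}).
Hypothesis psiE : forall a, psi a = h (phi a).

Lemma evp_map x p : evp psi (h x) p = h (evp phi x p : R).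
Proof.
rewrite /evp -horner_map; congr (_.[_]).
by rewrite -map_poly_comp; apply: eq_map_poly => a; rewrite /= psiE.
Qed.

Lemma ev2_map x y u : ev2 psi (h x) (h y) u = h (ev2 phi x y u : R).
Proof.
elim/tensor_ind: u => [p q||u v hu hv].
- by rewrite !tev_pure /= !evp_map rmorphM.
- by rewrite !linear0 rmorph0.
- by rewrite !linearD hu hv rmorphD.
Qed.

Lemma ev3_map x y z u :
  ev3 psi (h x) (h y) (h z) u = h (ev3 phi x y z u : R).
Proof.
elim/tensor_ind: u => [p q||u v hu hv].
- by rewrite !tev_pure /= ev2_map evp_map rmorphM.
- by rewrite !linear0 rmorph0.
- by rewrite !linearD hu hv rmorphD.
Qed.

End Transfer.

Let R1 := {poly F}.
Let R2 := {poly R1}.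
Let R3 := {poly R2}.
Let K := {fraction R3}.
Let phi1 : {rmorphism F -> R1} := polyC.
Let phi2 : {rmorphism F -> R2} := polyC \o phi1.
Let phi3 : {rmorphism F -> R3} := polyC \o phi2.

Definition genK : fieldType := K.
Definition genphi : {rmorphism F -> genK} := @tofrac R3 \o phi3.
Definition genx : genK := tofrac ('X%:P%:P : R3).
Definition geny : genK := tofrac ('X%:P : R3).
Definition genz : genK := tofrac ('X : R3).

Lemma ev1_inj p : evp phi1 'X p = 0 -> p = 0.
Proof. by rewrite /evp -/(comp_poly _ _) comp_polyXr. Qed.

Lemma ev2_inj u : ev2 phi2 'X%:P 'X u = 0 -> u = 0.
Proof.
apply: (tev_inj (f := evp phi1 'X)) => [p|]; last exact: ev1_inj.
exact: (evp_map (h := polyC)).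
Qed.

Lemma ev3_inj u : ev3 phi3 'X%:P%:P 'X%:P 'X u = 0 -> u = 0.
Proof.
apply: (tev_inj (f := ev2 phi2 'X%:P 'X)) => [p|]; last exact: ev2_inj.
exact: (ev2_map (h := polyC)).
Qed.

Lemma gen3_inj u v : ev3 genphi genx geny genz u = ev3 genphi genx geny genz v ->
  u = v.
Proof.
move/eqP; rewrite -subr_eq0 -linearB => /eqP.
rewrite [LHS](ev3_map (h := @tofrac R3) (phi := phi3)) // => /eqP.
by rewrite tofrac_eq0 => /eqP /ev3_inj /eqP; rewrite subr_eq0 => /eqP.
Qed.

Lemma gen2_inj u v : ev2 genphi genx geny u = ev2 genphi genx geny v -> u = v.
Proof.
move=> h; have /gen3_inj e : ev3 genphi genx geny genz (u ⊗ 1) =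
    ev3 genphi genx geny genz (v ⊗ 1) by rewrite !tev_pure /= h.
move/eqP: h; rewrite -subr_eq0 -linearB => /eqP.
rewrite [LHS](ev2_map (h := @tofrac R3) (phi := phi3)) // => /eqP.
rewrite tofrac_eq0 [X in X == 0](ev2_map (h := polyC) (phi := phi2)) //.
by rewrite polyC_eq0 => /eqP /ev2_inj /eqP; rewrite subr_eq0 => /eqP.
Qed.

Lemma polyC_neqX (R : nzRingType) (c : R) : c%:P != 'X.
Proof.
apply/eqP => /(congr1 (fun p : {poly R} => size p)).
by rewrite size_polyX size_polyC; case: (_ == _).
Qed.

Lemma gen_neq : [/\ genx != geny, geny != genz & genx != genz].
Proof.
split; rewrite tofrac_eq ?polyC_neqX //.
by rewrite (inj_eq polyC_inj) polyC_neqX.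
Qed.

End GenericPoints.

Section BracketEval.
Variables (F : fieldType) (K : fieldType) (phi : {rmorphism F -> K}).
Variables (br : double_bracket {poly F}) (c : K -> K -> K).
Local Notation e1 := (evp phi).
Local Notation e2 := (ev2 phi).
Local Notation e3 := (ev3 phi).
Hypothesis brE : forall x y p q, x != y ->
  e2 x y (br (p ⊗ q)) =
    c x y * ((e1 x p : K) * e1 y q - (e1 x q : K) * e1 y p) / (x - y) :> K.

Lemma ev3_assoc x y z p u :
  e3 x y z (tassoc (p ⊗ u)) = (e1 x p : K) * e2 y z u :> K.
Proof.
elim/tensor_ind: u => [q r||u v hu hv].
- by rewrite tassoc_pure !tev_pure mulrA.
- by rewrite linear0r !linear0 mulr0.
- by rewrite linearDr !linearD hu hv mulrDr.
Qed.

Lemma ev3_perm12 x y z u : e3 x y z (perm12 u) = e3 y x z u.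
Proof.
elim/tensor_ind: u => [u r||u v hu hv].
- by rewrite tmap_pure !tev_pure /= ev2_swap.
- by rewrite !linear0.
- by rewrite !linearD hu hv.
Qed.

Lemma ev3_perm23 x y z u : e3 x y z (perm23 u) = e3 x z y u.
Proof.
elim/tensor_ind: u => [u r||u v hu hv].
- elim/tensor_ind: u => [p q||u v hu hv].
  + by rewrite perm23_pure !tev_pure /= mulrAC.
  + by rewrite linear0l !linear0.
  + by rewrite linearDl !linearD hu hv.
- by rewrite !linear0.
- by rewrite !linearD hu hv.
Qed.

Lemma ev3_Lr x y z a u : x != y ->
  e3 x y z (bracket_Lr br a u) =
    c x y * ((e1 x a : K) * e2 y z u - (e2 x z u : K) * e1 y a) / (x - y) :> K.
Proof.
move=> nxy; elim/tensor_ind: u => [p q||u v hu hv].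
- rewrite /bracket_Lr tmap_pure tev_pure /= /bracketr brE // !tev_pure.
  by ring.
- by rewrite /bracket_Lr !linear0 mulr0 mul0r subrr mulr0 mul0r.
- move: hu hv; rewrite /bracket_Lr !linearD => -> ->; rewrite -mulrDl -mulrDr.
  by congr (_ * _ / _); rewrite mulrDr mulrDl opprD addrACA.
Qed.

Lemma ev3_R x y z a u : y != z ->
  e3 x y z (bracket_R br a u) =
    c y z * ((e1 y a : K) * e2 x z u - (e2 x y u : K) * e1 z a) / (y - z) :> K.
Proof.
move=> nyz; elim/tensor_ind: u => [p q||u v hu hv].
- rewrite /bracket_R tmap_pure ev3_assoc /= /bracketr brE // !tev_pure.
  by ring.
- by rewrite /bracket_R !linear0 mulr0 mul0r subrr mulr0 mul0r.
- move: hu hv; rewrite /bracket_R !linearD => -> ->; rewrite -mulrDl -mulrDr.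
  by congr (_ * _ / _); rewrite mulrDr mulrDl opprD addrACA.
Qed.

Lemma ev3_Ll x y z b u : x != z ->
  e3 x y z (bracket_Ll br u b) =
    c x z * ((e2 x y u : K) * e1 z b - (e1 x b : K) * e2 z y u) / (x - z) :> K.
Proof.
move=> nxz; elim/tensor_ind: u => [p q||u v hu hv].
- rewrite /bracket_Ll tmap_pure ev3_perm23 tev_pure /= /bracketl brE //.
  by rewrite !tev_pure; ring.
- by rewrite /bracket_Ll !linear0 mulr0 mul0r subrr mulr0 mul0r.
- move: hu hv; rewrite /bracket_Ll !linearD => -> ->; rewrite -mulrDl -mulrDr.
  by congr (_ * _ / _); rewrite mulrDr mulrDl opprD addrACA.
Qed.

Lemma ev_skew x y p q : x != y -> c x y - c y x = x - y ->
  e2 x y (br (p ⊗ q) + tswap (br (q ⊗ p))) =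
  e2 x y ((1 : F) *: (p ⊗ q - q ⊗ p)) :> K.
Proof.
move=> nxy cE; rewrite scale1r !linearD linearN ev2_swap !brE // 1?eq_sym //.
have nz : x - y != 0 by rewrite subr_eq0.
have nz' : y - x != 0 by rewrite subr_eq0 eq_sym.
have -> : c x y = c y x + (x - y) by rewrite -cE addrC subrK.
rewrite !tev_pure /=.
move: (e1 x p : K) (e1 y p : K) (e1 x q : K) (e1 y q : K) => px py qx qy.
by rewrite -[(_ : rscal phi) + _]/(_ + _ : K); field; rewrite nz nz'.
Qed.

Lemma ev_jacobi x y z p q r : x != y -> y != z -> x != z ->
  (c = (fun _ y => - y)) \/ (c = fun x _ => x) ->
  e3 x y z (bracket_Lr br p (br (q ⊗ r)) - bracket_R br q (br (p ⊗ r))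
      - bracket_Ll br (br (p ⊗ q)) r) =
  e3 x y z (- ((1 : F) *: perm12 (tassoc (q ⊗ br (p ⊗ r))))) :> K.
Proof.
move=> nxy nyz nxz cE; rewrite scale1r !linearB linearN.
rewrite ev3_perm12 ev3_assoc ev3_Lr // ev3_R // ev3_Ll // !brE // 1?eq_sym //.
have [n1 n2 n3] : [/\ x - y != 0, y - z != 0 & x - z != 0].
  by rewrite !subr_eq0.
have [m1 m2 m3] : [/\ y - x != 0, z - y != 0 & z - x != 0].
  by rewrite !subr_eq0 ![_ == x]eq_sym [z == y]eq_sym.
move: (e1 x p : K) (e1 y p : K) (e1 x q : K) (e1 y q : K) => px py qx qy.
move: (e1 z p : K) (e1 z q : K) (e1 x r : K) (e1 y r : K) => pz qz rx ry.
move: (e1 z r : K) => rz.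
rewrite -![(_ : rscal phi) + _]/(_ + _ : K) -![- (_ : rscal phi)]/(- (_ : K)).
by case: cE => ->; field; rewrite ?n1 ?n2 ?n3 ?m1 ?m2 ?m3.
Qed.

End BracketEval.


Section M1M2.
Variable F : fieldType.

Lemma evp_sum (K : fieldType) (phi : {rmorphism F -> K}) x (p : {poly F}) :
  evp phi x p = \sum_(i < size p) phi p`_i * x ^+ i :> K.
Proof.
rewrite -{1}[p]coefK poly_def linear_sum /=.
by apply: eq_bigr => i _; rewrite linearZ /= rscalE evpXn.
Qed.

Lemma linext2_ev (K : fieldType) (phi : {rmorphism F -> K}) g c x y p q :
  (forall n m, ev2 phi x y (g n m) =
     c * (x ^+ n * y ^+ m - x ^+ m * y ^+ n) / (x - y) :> K) ->
  ev2 phi x y (linext2 g (p ⊗ q)) =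
    c * ((evp phi x p : K) * evp phi y q - (evp phi x q : K) * evp phi y p)
      / (x - y) :> K.
Proof.
move=> gE.
have -> : ev2 phi x y (linext2 g (p ⊗ q)) =
    \sum_(i < size p) \sum_(j < size q) (phi p`_i * (phi q`_j *
      (c * (x ^+ i * y ^+ j - x ^+ j * y ^+ i) / (x - y)))) :> K.
  rewrite [X in ev2 _ _ _ X]tlift_pure /= /linext2_fun /linext linear_sum /=.
  apply: eq_bigr => i _; rewrite linearZ /= rscalE linear_sum /= mulr_sumr.
  by apply: eq_bigr => j _; rewrite linearZ /= rscalE gE.
rewrite !evp_sum [X in c * (_ - X)]mulrC !big_distrlr /= -sumrB mulr_sumr mulr_suml.
apply: eq_bigr => i _; rewrite -sumrB mulr_sumr mulr_suml.
by apply: eq_bigr => j _; ring.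
Qed.

Lemma ev2_div (K : fieldType) (phi : {rmorphism F -> K}) x y n : x != y ->
  tmul (x_sub_y F) (tdiv n (x_sub_y F)) = n ->
  ev2 phi x y (tdiv n (x_sub_y F)) = (ev2 phi x y n : K) / (x - y) :> K.
Proof.
move=> nxy nE; rewrite -{2}nE ev2M ev2_x_sub_y mulrC mulKf //.
by rewrite subr_eq0.
Qed.

Lemma M1_ev (K : fieldType) (phi : {rmorphism F -> K}) x y p q : x != y ->
  ev2 phi x y (M1_bracket F (p ⊗ q)) =
    - y * ((evp phi x p : K) * evp phi y q - (evp phi x q : K) * evp phi y p)
      / (x - y) :> K.
Proof.
move=> nxy; apply: linext2_ev => n m; rewrite linearN.
rewrite -[- (_ : rscal phi)]/(- (_ : K)) ev2_div ?M1_exact // linearB.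
rewrite !tev_pure /= !evpXn -[(_ : rscal phi) + _]/(_ + _ : K).
by rewrite !exprS; ring.
Qed.

Lemma M2_ev (K : fieldType) (phi : {rmorphism F -> K}) x y p q : x != y ->
  ev2 phi x y (M2_bracket F (p ⊗ q)) =
    x * ((evp phi x p : K) * evp phi y q - (evp phi x q : K) * evp phi y p)
      / (x - y) :> K.
Proof.
move=> nxy; apply: linext2_ev => n m.
rewrite ev2_div ?M2_exact // linearB.
rewrite !tev_pure /= !evpXn -[(_ : rscal phi) + _]/(_ + _ : K).
by rewrite !exprS; ring.
Qed.

Lemma M1_skew : skew_axiom (M1_bracket F) 1.
Proof.
move=> p q; have [nxy _ _] := gen_neq F; apply: gen2_inj.
apply: (ev_skew (c := fun _ y => - y)) => //; last by rewrite opprK addrC.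
by move=> x y a b; exact: M1_ev.
Qed.

Lemma M1_jacobi : jacobi_axiom (M1_bracket F) 1.
Proof.
move=> p q r; have [nxy nyz nxz] := gen_neq F.
set u := (X in X = _); set v := (X in _ = X).
have inj := @gen3_inj F u v; apply: inj; rewrite /u /v.
have brE x y a b := @M1_ev (genK F) (genphi F) x y a b.
have h := @ev_jacobi F _ _ _ (fun _ y => - y) brE _ _ _ p q r nxy nyz nxz.
by refine (etrans (h _) _) => //; left.
Qed.

Lemma M2_skew : skew_axiom (M2_bracket F) 1.
Proof.
move=> p q; have [nxy _ _] := gen_neq F; apply: gen2_inj.
apply: (ev_skew (c := fun x _ => x)) => //.
by move=> x y a b; exact: M2_ev.
Qed.

Lemma M2_jacobi : jacobi_axiom (M2_bracket F) 1.
Proof.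
move=> p q r; have [nxy nyz nxz] := gen_neq F.
set u := (X in X = _); set v := (X in _ = X).
have inj := @gen3_inj F u v; apply: inj; rewrite /u /v.
have brE x y a b := @M2_ev (genK F) (genphi F) x y a b.
have h := @ev_jacobi F _ _ _ (fun x _ => x) brE _ _ _ p q r nxy nyz nxz.
by refine (etrans (h _) _) => //; right.
Qed.

Definition M1 : double_lie (1 : F) {poly F} := DoubleLie M1_skew M1_jacobi.
Definition M2 : double_lie (1 : F) {poly F} := DoubleLie M2_skew M2_jacobi.

Lemma x_sub_y_reg (u v : tensor {poly F} {poly F}) :
  tmul (x_sub_y F) u = tmul (x_sub_y F) v -> u = v.
Proof.
have [nxy _ _] := gen_neq F => h; apply: gen2_inj.
have := congr1 (ev2 (genphi F) (genx F) (geny F)) h; rewrite !ev2M.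
by apply: mulfI; rewrite ev2_x_sub_y subr_eq0.
Qed.

Lemma M1E n m : tmul (x_sub_y F) (M1 ('X^n ⊗ 'X^m)) =
  - ('X^n ⊗ 'X^(m.+1) - 'X^m ⊗ 'X^(n.+1)).
Proof. by rewrite /= linext2_Xn tmulNr M1_exact. Qed.

Lemma M2E n m : tmul (x_sub_y F) (M2 ('X^n ⊗ 'X^m)) =
  'X^(n.+1) ⊗ 'X^m - 'X^(m.+1) ⊗ 'X^n.
Proof. by rewrite /= linext2_Xn M2_exact. Qed.

Definition t_ideal : {pred {poly F}} := [pred p | 'X %| p].

Lemma t_idealP (p : {poly F}) : reflect (exists q, p = 'X * q) (p \in t_ideal).
Proof.
by apply: (iffP (dvdpP _ _)) => -[q ->]; exists q; rewrite mulrC.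
Qed.

Lemma t_ideal_submod : subsemimod_closed t_ideal.
Proof.
split; last by move=> a p; rewrite !inE -mul_polyC; exact: dvdp_mull.
split=> [|p q]; rewrite !inE ?dvdp0 //; exact: dvdp_add.
Qed.
HB.instance Definition _ :=
  GRing.isSubSemiModClosed.Build F {poly F} t_ideal t_ideal_submod.

End M1M2.
Arguments t_ideal F : clear implicits.

(* Main.v *)
(* Write D(p, q) = (p(x) q(y) - q(x) p(y)) / (x - y), a polynomial symmetric in
   x and y. Then { p, q } is x D(p, q) on M2 and - y D(p, q) on M1, so the
   bracket of M1 is minus the flip of that of M2 and both have the same ideals.
   As D(t p, t q) = x y D(p, q), multiplication by t is an isomorphism onto
   t F[t].

   Let J be an ideal of M2. Applying a functional l vanishing on J to the left
   factor sends { J, V } and { V, J } into J. For f in J of minimal degree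
   n > 0, (l ⊗ id) { f, 1 } has degree < n and coefficient l(t) lead(f) at
   t^(n-1); hence it is 0 and l(t) = 0 for all l, i.e. t is in J. So J contains
   1 or t. If J contains t^a, then by induction it contains all t^m with m > a:
   { t^(2m-a), t^a } = sum_(i + j = 2m, a <= j < 2m - a) t^i ⊗ t^j, and l ⊗ l
   kills every term except t^m ⊗ t^m. *)

From HB Require Import structures.
Require Import Defs.
From mathcomp Require Import all_boot all_order all_algebra.
From mathcomp Require Import boolp ring zify.
Import GRing.Theory.
Local Open Scope ring_scope.

Set Implicit Arguments.
Unset Strict Implicit.
Unset Printing Implicit Defensive.

(** * Functoriality of tensor products and their permutations *)

Section TensorMapTheory.
Variable F : fieldType.

(** The composites enter as [h] and [k] with pointwise equations, so that a composite that is the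
    identity only pointwise can be given as [idfun]. *)
Lemma tmap_comp (U U' U'' V V' V'' : lmodType F)
    (f : {linear U' -> U''}) (g : {linear V' -> V''})
    (f' : {linear U -> U'}) (g' : {linear V -> V'})
    (h : {linear U -> U''}) (k : {linear V -> V''}) :
  (forall u, h u = f (f' u)) -> (forall v, k v = g (g' v)) ->
  forall x, tmap f g (tmap f' g' x) = tmap h k x.
Proof.
move=> hE kE; elim/tensor_ind=> [u v||x y hx hy].
- by rewrite !tmap_pure hE kE.
- by rewrite !linear0.
- by rewrite !linearD hx hy.
Qed.

Lemma tmap_id (U V : lmodType F) (f : {linear U -> U}) (g : {linear V -> V}) :
  f =1 id -> g =1 id -> tmap f g =1 id.
Proof.
move=> fE gE; elim/tensor_ind=> [u v||x y hx hy].
- by rewrite tmap_pure fE gE.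
- by rewrite linear0.
- by rewrite linearD hx hy.
Qed.

Lemma tmap_cancel (U U' V V' : lmodType F)
    (f : {linear U -> U'}) (f' : {linear U' -> U})
    (g : {linear V -> V'}) (g' : {linear V' -> V}) :
  cancel f f' -> cancel g g' -> cancel (tmap f g) (tmap f' g').
Proof.
move=> fK gK x.
by rewrite (@tmap_comp _ _ _ _ _ _ f' g' f g idfun idfun) ?tmap_id.
Qed.

Lemma tmap_swap (U U' V V' : lmodType F)
    (f : {linear U -> U'}) (g : {linear V -> V'}) x :
  tswap (tmap f g x) = tmap g f (tswap x).
Proof.
elim/tensor_ind: x => [u v||x y hx hy].
- by rewrite !tmap_pure !tswap_pure tmap_pure.
- by rewrite !linear0.
- by rewrite !linearD hx hy.
Qed.

Section Triple.
Variables (U U' : lmodType F) (f : {linear U -> U'}).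
Let f3 := tmap (tmap f f) f.

Lemma tmap_tassoc x : tassoc (tmap f (tmap f f) x) = f3 (tassoc x).
Proof.
elim/tensor_ind: x => [u x||x y hx hy]; last 2 first.
- by rewrite !linear0.
- by rewrite !linearD hx hy.
elim/tensor_ind: x => [v w||x y hx hy].
- by rewrite !tmap_pure !tassoc_pure [RHS]tmap_pure tmap_pure.
- by rewrite linear0r !linear0.
- by rewrite linearDr !linearD hx hy.
Qed.

Lemma tmap_perm12 x : perm12 (f3 x) = f3 (perm12 x).
Proof.
elim/tensor_ind: x => [x w||x y hx hy]; last 2 first.
- by rewrite !linear0.
- by rewrite !linearD hx hy.
elim/tensor_ind: x => [u v||x y hx hy].
- rewrite perm12_pure [X in perm12 X]tmap_pure [X in X ⊗ _]tmap_pure perm12_pure.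
  by rewrite [RHS]tmap_pure [X in _ = X ⊗ _]tmap_pure.
- by rewrite linear0l !linear0.
- by rewrite linearDl !linearD hx hy.
Qed.

Lemma tmap_perm23 x : perm23 (f3 x) = f3 (perm23 x).
Proof.
elim/tensor_ind: x => [x w||x y hx hy]; last 2 first.
- by rewrite !linear0.
- by rewrite !linearD hx hy.
elim/tensor_ind: x => [u v||x y hx hy].
- rewrite perm23_pure [X in perm23 X]tmap_pure [X in X ⊗ _]tmap_pure perm23_pure.
  by rewrite [RHS]tmap_pure [X in _ = X ⊗ _]tmap_pure.
- by rewrite linear0l !linear0.
- by rewrite linearDl !linearD hx hy.
Qed.

End Triple.
End TensorMapTheory.

(** * Transport of a double Lie structure along a linear isomorphism *)

Section Transport.
Variables (F : fieldType) (lambda : F) (V W : lmodType F).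
Variables (L : double_lie lambda V).
Variables (f : {linear V -> W}) (g : {linear W -> V}).
Hypotheses (fK : cancel f g).

Definition transport_bracket : double_bracket W :=
  tmap f f \o (L \o tmap g g).

Local Notation br := transport_bracket.
Local Notation f2 := (tmap f f).
Local Notation f3 := (tmap (tmap f f) f).

Lemma transport_bracketE a b : br (a ⊗ b) = f2 (L (g a ⊗ g b)).
Proof. by rewrite /= tmap_pure. Qed.

Lemma transport_bracketr a p :
  bracketr br a (f p) = f2 (bracketr L (g a) p).
Proof. by rewrite [LHS]transport_bracketE fK. Qed.

Lemma transport_bracketl c p :
  bracketl br c (f p) = f2 (bracketl L (g c) p).
Proof. by rewrite [LHS]transport_bracketE fK. Qed.

Lemma transport_Lr a u : bracket_Lr br a (f2 u) = f3 (bracket_Lr L (g a) u).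
Proof.
rewrite /bracket_Lr; elim/tensor_ind: u => [p q||x y hx hy].
- by rewrite !tmap_pure [X in X ⊗ _]transport_bracketr.
- by rewrite !linear0.
- by rewrite !linearD hx hy.
Qed.

Lemma transport_R a u : bracket_R br a (f2 u) = f3 (bracket_R L (g a) u).
Proof.
rewrite /bracket_R -tmap_tassoc; congr (tassoc _).
elim/tensor_ind: u => [p q||x y hx hy].
- by rewrite !tmap_pure [X in _ ⊗ X]transport_bracketr.
- by rewrite !linear0.
- by rewrite !linearD hx hy.
Qed.

Lemma transport_Ll u c : bracket_Ll br (f2 u) c = f3 (bracket_Ll L u (g c)).
Proof.
rewrite /bracket_Ll -tmap_perm23; congr (perm23 _).
elim/tensor_ind: u => [p q||x y hx hy].
- by rewrite !tmap_pure [X in X ⊗ _]transport_bracketl.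
- by rewrite !linear0.
- by rewrite !linearD hx hy.
Qed.

Hypothesis gK : cancel g f.

Lemma transport_skew : skew_axiom br lambda.
Proof.
move=> a b; rewrite !transport_bracketE tmap_swap -linearD dbr_skew.
by rewrite linearZ linearB /= !tmap_pure !gK.
Qed.

Lemma transport_jacobi : jacobi_axiom br lambda.
Proof.
move=> a b c; rewrite !transport_bracketE.
rewrite transport_Lr transport_R transport_Ll -!linearB dbr_jacobi.
rewrite linearN linearZ /= -tmap_perm12 -tmap_tassoc.
by rewrite [X in tassoc X]tmap_pure gK.
Qed.

Definition transport : double_lie lambda W :=
  DoubleLie transport_skew transport_jacobi.

Lemma transport_isomorphic : dlie_isomorphic transport L.
Proof.
exists g; split=> [|a b]; first by exists f.
by rewrite transport_bracketE tmap_cancel.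
Qed.

End Transport.

(** * Identities for the two brackets, checked at pairs of distinct points *)

Section Formulas.
Variable F : fieldType.
Local Notation V := {poly F}.

Section Eval.
Variables (K : fieldType) (phi : {rmorphism F -> K}) (x y : K).
Hypothesis nxy : x != y.
Local Notation e2 := (ev2 phi x y).

Lemma evpX z : evp phi z 'X = z.
Proof. by rewrite -['X]expr1 evpXn. Qed.

Lemma ev2_M1_swapM2 (p q : V) :
  e2 (M1 F (p ⊗ q)) = e2 (- tswap (M2 F (p ⊗ q))).
Proof.
rewrite [LHS]M1_ev // linearN /= ev2_swap [X in _ = - X]M2_ev 1?eq_sym //.
have n1 : x - y != 0 by rewrite subr_eq0.
have n2 : y - x != 0 by rewrite subr_eq0 eq_sym.
move: (evp phi x p : K) (evp phi y p : K) (evp phi x q : K) (evp phi y q : K).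
move=> px py qx qy; rewrite -[- (_ : rscal phi)]/(- (_ : K)).
by field; rewrite n1 n2.
Qed.

Lemma ev2_M2_antisym (p q : V) :
  e2 (M2 F (p ⊗ q)) = e2 (- M2 F (q ⊗ p)).
Proof.
rewrite [LHS]M2_ev // linearN /= [X in _ = - X]M2_ev //.
rewrite -[- (_ : rscal phi)]/(- (_ : K)) -[RHS]mulNr; congr (_ / _).
by rewrite -[RHS]mulrN opprB.
Qed.

(** Factoring out [x^(a+1) y^a] leaves the geometric sum for [(x^k - y^k) / (x - y)]. *)
Lemma ev2_M2_Xn a k : e2 (M2 F ('X^(a + k) ⊗ 'X^a)) =
  e2 (\sum_(i < k) 'X^(a + k - i) ⊗ 'X^(a + i)).
Proof.
have n1 : x - y != 0 by rewrite subr_eq0.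
rewrite [LHS]M2_ev // !evpXn linear_sum /=.
transitivity (\sum_(i < k) x ^+ (a + k - i) * y ^+ (a + i)); last first.
  by apply: eq_bigr => i _; rewrite tev_pure /= !evpXn.
rewrite -[RHS](mulfK n1); congr (_ / _).
have -> : \sum_(i < k) x ^+ (a + k - i) * y ^+ (a + i) =
    x * x ^+ a * y ^+ a * \sum_(i < k) x ^+ (k.-1 - i) * y ^+ i.
  rewrite mulr_sumr; apply: eq_bigr => i _.
  have -> : (a + k - i = 1 + a + (k.-1 - i))%N.
    (* An index [i] exists only when [k > 0], so [k.-1] is a genuine predecessor. *)
    by case: (k) i => [[]//|k' i] /=; have := ltn_ord i; lia.
  by rewrite !exprD expr1; ring.
by rewrite -[RHS]mulrA [_ * (x - y)]mulrC -subrXX !exprD; ring.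
Qed.

(** Each tensor factor gains its own variable. The map [m] is left abstract because it is later
    [mulX] followed by the inclusion of t F[t]. *)
Lemma ev2_mulX (m : {linear V -> V}) u : (forall r, m r = 'X * r) ->
  e2 (tmap m m u) = x * y * e2 u :> K.
Proof.
move=> mE; elim/tensor_ind: u => [a b||u v hu hv].
- rewrite tmap_pure !tev_pure /= !mE !evpM !evpX.
  by rewrite mulrACA.
- by rewrite !linear0 mulr0.
- by rewrite !linearD hu hv mulrDr.
Qed.

Lemma ev2_M2_mulX (m : {linear V -> V}) (p q : V) : (forall r, m r = 'X * r) ->
  e2 (M2 F (m p ⊗ m q)) = e2 (tmap m m (M2 F (p ⊗ q))).
Proof.
move=> mE; rewrite [LHS]M2_ev // ev2_mulX // [X in _ = _ * X]M2_ev //.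
rewrite !mE !evpM !evpX [RHS]mulrA.
by congr (_ / _); ring.
Qed.

End Eval.

Lemma M1_swapM2 u : M1 F u = - tswap (M2 F u).
Proof.
elim/tensor_ind: u => [p q||u v hu hv]; first last.
- by rewrite !linearD hu hv.
- by rewrite !linear0.
(* The generic point has independent indeterminates as coordinates, so equal values there force
   equal tensors. *)
by have [nxy _ _] := gen_neq F; apply: gen2_inj; exact: ev2_M1_swapM2.
Qed.

Lemma M2_antisym (p q : V) : M2 F (p ⊗ q) = - M2 F (q ⊗ p).
Proof.
by have [nxy _ _] := gen_neq F; apply: gen2_inj; exact: ev2_M2_antisym.
Qed.

Lemma M2_Xn a k :
  M2 F ('X^(a + k) ⊗ 'X^a) = \sum_(i < k) 'X^(a + k - i) ⊗ 'X^(a + i).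
Proof. by have [nxy _ _] := gen_neq F; apply: gen2_inj; exact: ev2_M2_Xn. Qed.

Lemma M2_mulX (m : {linear V -> V}) (p q : V) : (forall r, m r = 'X * r) ->
  M2 F (m p ⊗ m q) = tmap m m (M2 F (p ⊗ q)).
Proof.
move=> mE.
by have [nxy _ _] := gen_neq F; apply: gen2_inj; exact: ev2_M2_mulX.
Qed.

(** Bilinearity reduces to pairs of monomials, and [M2_antisym] puts the larger exponent on the
    left. *)
Lemma M2_ind (P : tensor V V -> Prop) :
  P 0 -> (forall u v, P u -> P v -> P (u + v)) ->
  (forall a u, P u -> P (a *: u)) ->
  (forall a k, P (M2 F ('X^(a + k) ⊗ 'X^a))) -> forall u, P (M2 F u).
Proof.
move=> P0 PD PZ PX; have PN u : P u -> P (- u).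
  by rewrite -scaleN1r; exact: PZ.
have PXX n m : P (M2 F ('X^n ⊗ 'X^m)).
  case: (leqP m n) => [le_mn|/ltnW le_nm].
    by have := PX m (n - m)%N; rewrite subnKC.
  by rewrite M2_antisym; apply: PN; have := PX n (m - n)%N; rewrite subnKC.
move=> u; elim/tensor_ind: u => [p q||u v hu hv].
- rewrite [M2 F _]tlift_pure /= /linext2_fun /linext.
  apply: (big_ind P) => // i _; apply/PZ.
  apply: (big_ind P) => // j _; apply/PZ.
  by have := PXX i j; rewrite /= linext2_Xn.
- by rewrite linear0.
- by rewrite linearD; apply: PD.
Qed.

End Formulas.

(** * The subspace I ⊗ V + V ⊗ I and contraction by functionals *)

Section IdealTensor.
Variables (F : fieldType) (V : lmodType F) (I : submodClosed V).
Local Notation J2 := (in_ideal_tensor I).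

Lemma in_ideal_tensor0 : J2 0.
Proof. by exists 0, 0; rewrite !linear0 addr0. Qed.

Lemma in_ideal_tensorD u v : J2 u -> J2 v -> J2 (u + v).
Proof.
move=> [y [z ->]] [y' [z' ->]]; exists (y + y'), (z + z').
by rewrite !linearD addrACA.
Qed.

Lemma in_ideal_tensorZ a u : J2 u -> J2 (a *: u).
Proof.
by move=> [y [z ->]]; exists (a *: y), (a *: z); rewrite !linearZ scalerDr.
Qed.

Lemma in_ideal_tensorN u : J2 u -> J2 (- u).
Proof. by rewrite -scaleN1r; exact: in_ideal_tensorZ. Qed.

Lemma in_ideal_tensor_swap u : J2 u -> J2 (tswap u).
Proof.
move=> [y [z ->]]; exists (tswap z), (tswap y).
by rewrite linearD /= !tmap_swap addrC.
Qed.

Lemma in_ideal_tensor_purel u v : u \in I -> J2 (u ⊗ v).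
Proof.
move=> uI; exists ((exist _ u uI : subspace I) ⊗ v), 0.
by rewrite linear0 addr0 tmap_pure.
Qed.

Definition slice_fun (l : {scalar V}) (u v : V) : V := l u *: v.

Lemma slice_bilinear l : bilinear_for *:%R *:%R (slice_fun l).
Proof.
apply: bilinearP => [v|u] a x y; rewrite /slice_fun.
  by rewrite linearP scalerDl scalerA.
by rewrite scalerDr !scalerA mulrC.
Qed.
HB.instance Definition _ l := bilinear_isBilinear.Build F V V V
  *:%R *:%R (slice_fun l) (slice_bilinear l).

(** The contraction [l ⊗ id], with F ⊗ V identified with V. *)
Definition slice (l : {scalar V}) : {linear tensor V V -> V} :=
  tlift (slice_fun l).

Lemma slice_pure l u v : slice l (u ⊗ v) = l u *: v.
Proof. exact: tlift_pure. Qed.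

(** The contraction kills I ⊗ V and sends V ⊗ I into I. *)
Lemma slice_in (l : {scalar V}) u :
  (forall v, v \in I -> l v = 0) -> J2 u -> slice l u \in I.
Proof.
move=> l0 [y [z ->]]; rewrite linearD rpredD //.
- elim/tensor_ind: y => [v w||y1 y2 hy1 hy2].
  + by rewrite tmap_pure slice_pure l0 ?scale0r ?rpred0 //; exact: valP.
  + by rewrite !linear0 rpred0.
  + by rewrite !linearD rpredD.
- elim/tensor_ind: z => [v w||z1 z2 hz1 hz2].
  + by rewrite tmap_pure slice_pure rpredZ //; exact: valP.
  + by rewrite !linear0 rpred0.
  + by rewrite !linearD rpredD.
Qed.

End IdealTensor.

(** * Functionals separating a polynomial from a subspace *)

Section Separation.
Variables (F : fieldType) (J : submodClosed {poly F}).
Implicit Types g p q r : {poly F}.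

(* No monomial of r has the degree of an element of J. Every class modulo J has
   a unique such representative, which splits J off without choosing a basis. *)
Definition reduced r :=
  forall i, r`_i != 0 -> forall g, g \in J -> size g != i.+1.

Lemma reducedP a r r' : reduced r -> reduced r' -> reduced (a *: r + r').
Proof.
move=> hr hr' i; rewrite coefD coefZ => nz.
have [r0|/hr//] := eqVneq r`_i 0.
by apply: hr'; move: nz; rewrite r0 mulr0 add0r.
Qed.

(** A nonzero [r] would itself be an element of [J] with the degree of its leading monomial. *)
Lemma reduced_in r : reduced r -> r \in J -> r = 0.
Proof.
move=> hr rJ; apply/eqP; apply: contraT => nz.
have := hr (size r).-1; rewrite -[r`_ _]/(lead_coef r) lead_coef_eq0 nz.
by move=> /(_ isT _ rJ); rewrite prednK ?eqxx // size_poly_gt0.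
Qed.

Lemma size_cancel_lead (g p : {poly F}) : size g = size p -> p != 0 ->
  (size (p - (lead_coef p / lead_coef g) *: g)%R < size p)%N.
Proof.
move=> sg nzp; have nzg : g != 0 by rewrite -size_poly_gt0 sg size_poly_gt0.
rewrite -(prednK (_ : 0 < size p)%N) ?size_poly_gt0 // ltnS.
apply/leq_sizeP => j; rewrite leq_eqVlt => /predU1P [<-|ltj].
  rewrite coefB coefZ -{2}sg -/(lead_coef p) -/(lead_coef g).
  by rewrite divfK ?lead_coef_eq0 // subrr.
rewrite coefB coefZ !nth_default ?mulr0 ?subr0 //.
  by rewrite sg; apply: leq_trans ltj; exact: leqSpred.
by apply: leq_trans ltj; exact: leqSpred.
Qed.

(** Induction on the size: an element of [J] of the same size as [p], if there is one, cancels the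
    leading term; otherwise that term is allowed in a reduced polynomial and moves to the
    remainder. *)
Lemma reduction_exists p : exists2 r, reduced r & p - r \in J.
Proof.
have [n] := ubnP (size p); elim: n p => // n IHn p ltp.
have [->|nzp] := eqVneq p 0.
  by exists 0; [move=> i; rewrite coef0 eqxx | rewrite subr0 rpred0].
have [[g gJ sg]|noJ] := pselect (exists2 g, g \in J & size g = size p).
  have ltq := size_cancel_lead sg nzp.
  have [r hr prJ] := IHn _ (leq_trans ltq ltp).
  exists r => //; rewrite -[p](subrK ((lead_coef p / lead_coef g) *: g)).
  by rewrite addrAC rpredD // rpredZ.
have sX : size ('X^((size p).-1) : {poly F}) = size p.
  by rewrite size_polyXn prednK // size_poly_gt0.
have ltq := size_cancel_lead sX nzp.
have [r hr prJ] := IHn _ (leq_trans ltq ltp).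
(* The divisor is 1; it is kept so that the remainder matches [size_cancel_lead]. *)
exists (lead_coef p / lead_coef 'X^((size p).-1) *: 'X^((size p).-1) + r).
  apply: reducedP => // i; rewrite coefXn.
  have [->|] := eqVneq i (size p).-1; last by rewrite eqxx.
  move=> _ g gJ; rewrite prednK ?size_poly_gt0 //; apply/eqP => sg.
  by apply: noJ; exists g.
by rewrite opprD addrA.
Qed.

Definition reduction p := s2val (cid2 (reduction_exists p)).

Lemma reduction_reduced p : reduced (reduction p).
Proof. exact: s2valP (cid2 (reduction_exists p)). Qed.

Lemma reduction_mod p : p - reduction p \in J.
Proof. exact: s2valP' (cid2 (reduction_exists p)). Qed.

(** The difference of two candidates is reduced and lies in [J], hence vanishes. *)
Lemma reduction_unique p r : reduced r -> p - r \in J -> reduction p = r.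
Proof.
move=> hr prJ; apply/eqP; rewrite -subr_eq0; apply/eqP/reduced_in.
  rewrite addrC -scaleN1r; apply: reducedP => //; exact: reduction_reduced.
have -> : reduction p - r = (p - r) - (p - reduction p) by ring.
by rewrite -[- (p - reduction p)]scaleN1r rpredD ?rpredZ // reduction_mod.
Qed.

(** Uniqueness makes the choice linear, since a combination of remainders is a reduced remainder of
    the combination. *)
Lemma reduction_linear : linear reduction.
Proof.
move=> a p q; apply: reduction_unique.
  by apply: reducedP; exact: reduction_reduced.
rewrite opprD addrACA -scalerBr rpredD ?rpredZ //; exact: reduction_mod.
Qed.
HB.instance Definition _ := GRing.isLinear.Build F {poly F} {poly F} *:%R
  reduction reduction_linear.

(** The functional takes the coefficient of the reduction at the degree of [reduction p]. It
    vanishes on [J] because the reduction does, and at [p] it gives the leading coefficient of a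
    nonzero polynomial. *)
Lemma separating_scalar p : p \notin J ->
  exists2 l : {scalar {poly F}}, (forall q, q \in J -> l q = 0) & l p != 0.
Proof.
move=> pJ; exists (coefp (size (reduction p)).-1 \o reduction) => [q qJ|].
  rewrite /= (reduction_unique (r := 0)) ?coef0 ?subr0 //.
  by move=> i; rewrite coef0 eqxx.
rewrite /= -[_`_ _]/(lead_coef _) lead_coef_eq0; apply: contra pJ => /eqP e.
by have := reduction_mod p; rewrite e subr0.
Qed.

End Separation.

(** * Classification of the ideals of [M2] *)

Section IdealsOfM2.
Variables (F : fieldType) (J : submodClosed {poly F}).
Hypothesis J_ideal : is_ideal (M2 F) J.

Lemma ideal_Xn a m : 'X^a \in J -> (a <= m)%N -> 'X^m \in J.
Proof.
move=> aJ; elim/ltn_ind: m => m IHm; rewrite leq_eqVlt => /predU1P [<- //|ltam].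
apply: contraT => /separating_scalar [l l0 lm].
(* With this [k] the exponents [a + k - i] and [a + i] add up to 2m, and both equal [m] at the index
   [m - a]. *)
have [k kE] : exists k, k = (2 * (m - a))%N by exists (2 * (m - a))%N.
have ltk : (m - a < k)%N by lia.
have := l0 _ (slice_in l0 (J_ideal 'X^(a + k)%N aJ).1).
rewrite M2_Xn [slice l _]linear_sum linear_sum.
rewrite (bigD1 (Ordinal ltk)) //= big1 => [|i ne].
  rewrite addr0 slice_pure linearZ /= subnKC ?(ltnW ltam) //.
  have -> : (a + k - (m - a) = m)%N by lia.
  by move/eqP; rewrite mulf_eq0 orbb (negPf lm).
have ltik := ltn_ord i; rewrite slice_pure linearZ /=.
have {}ne : (i != m - a :> nat)%N by [].
(* On either side of the middle index, one of the two exponents lies in [[a, m)], so [l] kills that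
   factor by induction. *)
have [lti|gti] := ltnP i (m - a)%N.
  by rewrite (l0 'X^(a + i)%N) ?mulr0 // IHm //; lia.
by rewrite (l0 'X^(a + k - i)%N) ?mul0r // IHm //; lia.
Qed.

Lemma ideal_Xn_dvd a p : 'X^a \in J -> 'X^a * p \in J.
Proof.
move=> aJ; rewrite -[p]coefK poly_def mulr_sumr.
apply: rpred_sum => i _; rewrite -scalerAr rpredZ // -exprD.
by apply: (ideal_Xn aJ); exact: leq_addr.
Qed.

Lemma slice_M2_1 (l : {scalar {poly F}}) f :
  slice l (M2 F (f ⊗ 1)) =
    \sum_(k < size f) f`_k *: \sum_(i < k) l 'X^(k - i)%N *: 'X^i.
Proof.
rewrite -[M2 F _]/(bracketl (M2 F) 1 f) -{1}[f]coefK poly_def.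
rewrite [bracketl _ _ _]linear_sum [LHS]linear_sum.
apply: eq_bigr => k _; rewrite [X in slice l X]linearZ [LHS]linearZ.
congr (_ *: _).
have := M2_Xn F 0 k; rewrite add0n expr0 => M2E.
rewrite [X in slice l X]M2E [LHS]linear_sum.
by apply: eq_bigr => i _; rewrite slice_pure add0n.
Qed.

Lemma ideal_X f : f \in J -> (1 < size f)%N ->
  (forall g, g \in J -> (size g < size f)%N -> g = 0) -> 'X \in J.
Proof.
(* Here [f] has degree [n + 1], so [n] is the exponent of the coefficient to be read off. *)
move=> fJ; case En: (size f) => [|[|n]] // _ fmin.
apply: contraT => /separating_scalar [l l0 lX].
set u := slice l (M2 F (f ⊗ 1)).
have uJ : u \in J by apply: slice_in => //; exact: (J_ideal 1 fJ).2.
have coefu j : u`_j =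
    \sum_(k < n.+2) f`_k * \sum_(i < k) l 'X^(k - i)%N * (j == i)%:R.
  rewrite /u slice_M2_1 En coef_sum; apply: eq_bigr => k _.
  rewrite coefZ coef_sum; congr (_ * _); apply: eq_bigr => i _.
  by rewrite coefZ coefXn.
have u0 : u = 0.
  apply: fmin => //; rewrite ltnS; apply/leq_sizeP => j ltj.
  rewrite coefu big1 // => k _; rewrite big1 ?mulr0 // => i _.
  rewrite gtn_eqF ?mulr0 //; apply: leq_trans ltj.
  by rewrite (leq_trans (ltn_ord i)) // -ltnS.
(* At t^n only the indices [k = n + 1] and [i = n] contribute, leaving [lead_coef f] times
   [l 'X]. *)
have := coefu n; rewrite u0 coef0 big_ord_recr /= big1 => [|k _]; last first.
  rewrite big1 ?mulr0 // => i _; rewrite gtn_eqF ?mulr0 //.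
  by rewrite (leq_trans (ltn_ord i)) // -ltnS.
rewrite add0r big_ord_recr /= big1 => [|i _]; last by rewrite gtn_eqF ?mulr0.
rewrite add0r eqxx mulr1 subSnn expr1 => /esym/eqP.
rewrite mulf_eq0 (negPf lX) orbF -[n.+1]/(n.+2.-1) -En.
by rewrite -[_`_ _]/(lead_coef f) lead_coef_eq0 -size_poly_eq0 En.
Qed.

Lemma M2_ideal_unique :
  (exists2 p, p \in J & p != 0) -> (exists p, p \notin J) -> J =i t_ideal F.
Proof.
move=> [p pJ nzp] [q qJ].
(* As ['X^0] is 1, [ideal_Xn_dvd] would put every polynomial into [J]. *)
have J1 : 1 \notin J.
  apply: contra qJ; rewrite -(expr0 'X) => /(ideal_Xn_dvd q).
  by rewrite expr0 mul1r.
have JC c : c%:P \in J -> c = 0.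
  move=> cJ; apply/eqP; apply: contraT => nzc; case/negP: J1.
  have -> : (1 : {poly F}) = c^-1 *: c%:P by rewrite -mul_polyC -polyCM mulVf.
  by rewrite rpredZ.
have JX : 'X \in J.
  pose P n := `[< exists g, [/\ g \in J, g != 0 & size g = n] >].
  have exP : exists n, P n by exists (size p); apply/asboolP; exists p.
  case: (ex_minnP exP) => n /asboolP [f [fJ nzf sf]] nmin.
  apply: (ideal_X fJ).
    (* A polynomial of size at most 1 is constant, hence zero by [JC] when it lies in [J]. *)
    rewrite ltnNge; apply: contra nzf => /size1_polyC fE.
    by rewrite fE (JC f`_0) // -fE.
  move=> g gJ; rewrite sf => ltg; apply/eqP; apply: contraTT ltg => nzg.
  by rewrite -leqNgt; apply: nmin; apply/asboolP; exists g.
have tJ r : 'X * r \in J by apply: (ideal_Xn_dvd (a := 1)).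
move=> r; apply/idP/t_idealP => [|[s ->] //].
(* Writing [r = s * 'X + c] and removing the multiple of ['X], which is in [J], leaves a constant in
   [J]. *)
elim/poly_ind: r => [|s c _] rJ; first by exists 0; rewrite mulr0.
exists s; suff -> : c = 0 by rewrite addr0 mulrC.
apply: JC; have -> : c%:P = s * 'X + c%:P + (-1) *: ('X * s).
  by rewrite scaleN1r mulrC addrC addKr.
by rewrite rpredD // rpredZ.
Qed.

End IdealsOfM2.

(** * Comparison of the ideals of [M1] and [M2], and t F[t] as an ideal *)

Lemma is_ideal_M1_M2 (F : fieldType) (J : submodClosed {poly F}) :
  is_ideal (M1 F) J <-> is_ideal (M2 F) J.
Proof.
have swapK (u : tensor {poly F} {poly F}) : tswap (tswap u) = u.
  elim/tensor_ind: u => [p q||u v hu hv]; first by rewrite !tswap_pure.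
    by rewrite !linear0.
  by rewrite !linearD hu hv.
(* The flip exchanges J ⊗ V and V ⊗ J, so it preserves their sum. *)
have in21 u : in_ideal_tensor J (M2 F u) -> in_ideal_tensor J (M1 F u).
  by move=> h; rewrite M1_swapM2; apply/in_ideal_tensorN/in_ideal_tensor_swap.
have in12 u : in_ideal_tensor J (M1 F u) -> in_ideal_tensor J (M2 F u).
  rewrite M1_swapM2 => /in_ideal_tensorN; rewrite opprK.
  by move/in_ideal_tensor_swap; rewrite swapK.
by split=> h v i /(h v) [h1 h2]; split; (apply: in12 || apply: in21).
Qed.

(** Every value of the bracket already lies in J ⊗ V: in [M2_Xn] the left exponents [a + k - i] are
    positive because [i < k]. *)
Lemma t_ideal_is_ideal_M2 (F : fieldType) (J : submodClosed {poly F}) :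
  J =i t_ideal F -> is_ideal (M2 F) J.
Proof.
move=> Jt; suff h u : in_ideal_tensor J (M2 F u) by move=> v i _; split.
apply: M2_ind => [|v w|a v|a k].
- exact: in_ideal_tensor0.
- exact: in_ideal_tensorD.
- exact: in_ideal_tensorZ.
rewrite M2_Xn; apply: (big_ind (in_ideal_tensor J)) => [|v w|i _].
- exact: in_ideal_tensor0.
- exact: in_ideal_tensorD.
apply: in_ideal_tensor_purel; rewrite Jt; apply/t_idealP.
exists 'X^((a + k - i).-1)%N; rewrite -exprS prednK //; have := ltn_ord i; lia.
Qed.

(** * Multiplication by t as an isomorphism onto t F[t], and the conclusion *)

Section TIdeal.
Variable F : fieldType.

Lemma mulX_t_ideal (p : {poly F}) : 'X * p \in t_ideal F.
Proof. by apply/t_idealP; exists p. Qed.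

Definition mulX (p : {poly F}) : subspace (t_ideal F) :=
  exist _ ('X * p) (mulX_t_ideal p).

Lemma mulX_linear : linear mulX.
Proof. by move=> a p q; apply: val_inj; rewrite /= mulrDr -scalerAr. Qed.
HB.instance Definition _ := GRing.isLinear.Build F {poly F}
  (subspace (t_ideal F)) *:%R mulX mulX_linear.

Definition divX (p : subspace (t_ideal F)) : {poly F} := val p %/ 'X.

Lemma divX_linear : linear divX.
Proof. by move=> a p q; rewrite /divX /= divpD divpZl. Qed.
HB.instance Definition _ := GRing.isLinear.Build F
  (subspace (t_ideal F)) {poly F} *:%R divX divX_linear.

Lemma mulXK : cancel mulX divX.
Proof. by move=> p; rewrite /divX /= mulKp // polyX_eq0. Qed.

Lemma divXK : cancel divX mulX.
Proof.
by move=> p; apply: val_inj; rewrite /= mulrC divpK //; exact: (valP p).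
Qed.

End TIdeal.

Theorem proposition6 (F : fieldType) (M : double_lie (1 : F) {poly F})
    (hM : M = M1 F \/ M = M2 F) :
  (forall J : submodClosed {poly F},
     (is_ideal M J /\ (exists2 p, p \in J & p != 0) /\ (exists p, p \notin J))
     <-> J =i t_ideal F) /\
  (exists N : double_lie (1 : F) (subspace (t_ideal F)),
     is_restriction M N /\ dlie_isomorphic N M).
Proof.
have idealE J : is_ideal M J <-> is_ideal (M2 F) J.
  by case: hM => ->; [exact: is_ideal_M1_M2|split].
have mulXE (m : {linear {poly F} -> {poly F}}) p q :
    (forall r, m r = 'X * r) -> M (m p ⊗ m q) = tmap m m (M (p ⊗ q)).
  move=> mE; case: hM => ->; last exact: M2_mulX.
  by rewrite !M1_swapM2 M2_mulX // tmap_swap linearN.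
split=> [J|].
  split=> [[/idealE hJ [nz pr]]|Jt]; first exact: M2_ideal_unique.
  split; first by apply/idealE/t_ideal_is_ideal_M2.
  split.
    by exists 'X; rewrite ?polyX_eq0 // Jt inE dvdpp.
  by exists 1; rewrite Jt inE dvdp1 size_polyX.
(* Transport along [mulX] gives the isomorphism at once; what remains is that the transported
   bracket is the restriction of [M]. *)
exists (transport M (@mulXK F) (@divXK F)); split; last first.
  exact: transport_isomorphic.
move=> a b; rewrite [X in tmap _ _ X]transport_bracketE.
(* By [mulXE], applying [m ⊗ m] to the bracket of [divX a] and [divX b] gives the bracket of their
   multiples by t, which are [a] and [b]. *)
pose m := incl (t_ideal F) \o @mulX F.
rewrite (tmap_comp (h := m) (k := m)) // -mulXE //.
have mE p : m (divX p) = incl (t_ideal F) p := congr1 val (divXK p).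
by congr (M (_ ⊗ _)); exact: mE.
Qed.
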